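(* Let $\Lambda$ be a real interval, $X$ a Fréchet space, $(e_n)_{n \geq 0}$ an unconditional basis of $X$ and $(w_n(\lambda))_{(n, \lambda) \in \mathbb{N} \times \Lambda}$ a family of positive numbers such that for any $\lambda \in \Lambda$, the weighted shift $B_{w(\lambda)}$ with weight sequence $w(\lambda) = (w_n(\lambda))_{n \geq 1}$ is an operator on $X$. Suppose that (i) for any $n \geq 1$, the function $w_n : \Lambda \to \mathbb{R} : \lambda \mapsto w_n(\lambda)$ is increasing; (ii) for any $\lambda \in \Lambda$, the series $\sum_{\nu \geq 1} \frac{1}{w_1(\lambda) \cdots w_\nu(\lambda)} e_\nu$ converges in $X$; (iii) for any compact subinterval $K$ of $\Lambda$ and any $n \in \mathbb{N}$, there exists some $L_n(K) > 0$ such that for all $\lambda, \mu \in K$, $\vert \log(w_n(\lambda)) - \log(w_n(\mu)) \vert \leq L_n(K) \vert \lambda - \mu \vert$; (iv) for any compact subinterval $K$ of $\Lambda$ and any $s \in \mathbb{N}$, with these numbers $L_i(K)$, the series $\sum_{t \geq 1} \big( \sum_{i = 1}^{s^t} L_i(K) \big)^{-1}$ diverges. Then the set of common upper frequently hypercyclic vectors for $(B_{w(\lambda)})_{\lambda \in \Lambda}$ is residual in $X$, and in particular, non-empty.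
   Context: $\mathbb{N}$ denotes the positive integers and $\mathbb{N}_0$ the nonnegative integers. ''Increasing'' is understood in the weak sense: $\lambda \leq \mu$ implies $w_n(\lambda) \leq w_n(\mu)$. An operator on a Fréchet space $X$ is a (well-defined) continuous linear map $X \to X$. For a Fréchet space $X$ with unconditional basis $(e_n)_{n \geq 0}$ and a sequence $w = (w_n)_{n \geq 1}$ of nonzero scalars, the weighted shift $B_w$ is the map defined, for $x = \sum_{n \geq 0} x_n e_n \in X$, by $B_w(x) := \sum_{n \geq 0} w_{n+1} x_{n+1} e_n$ (it need not be well defined on $X$ in general). The upper density of $A \subset \mathbb{N}_0$ is $\overline{\mathrm{dens}}(A) = \limsup_{n \to \infty} \frac{\#(A \cap [0,n])}{n+1}$. A vector $x \in X$ is upper frequently hypercyclic for an operator $T$ if for any non-empty open subset $U$ of $X$, $\overline{\mathrm{dens}}(\{ m \geq 0 \mid T^m(x) \in U \}) > 0$. A vector is a common upper frequently hypercyclic vector for a family of operators if it is upper frequently hypercyclic for every operator of the family. A set is residual if it contains a countable intersection of dense open sets. *)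

(* Defs.v *)
From HB Require Import structures.
From mathcomp Require Import all_boot all_order all_algebra.
From mathcomp Require Import all_classical all_reals all_analysis.
From mathcomp Require Import complex.

Set Implicit Arguments.
Unset Strict Implicit.
Unset Printing Implicit Defensive.

Import Order.TTheory GRing.Theory Num.Theory.
Import numFieldNormedType.Exports.

Local Open Scope classical_set_scope.
Local Open Scope ring_scope.

(* Vector spaces are real or complex: [scalar_field R false] is R and
   [scalar_field R true] is R[i]. *)
Definition scalar_field (R : realType) (cplx : bool) : numFieldType :=
  if cplx then (R[i] : numFieldType) else (R : numFieldType).

Definition of_real (R : realType) (cplx : bool) : R -> scalar_field R cplx :=
  if cplx return R -> scalar_field R cplx then @real_complex R else id.

(* As with norms in MathComp, seminorms take their values in K; the condition
   [0 <= p x] forces them to be real when K is R[i]. *)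
Record is_seminorm (K : numFieldType) (X : lmodType K) (p : X -> K) : Prop := {
  seminorm_ge0 : forall x, 0 <= p x ;
  seminormD : forall x y, p (x + y) <= p x + p y ;
  seminormZ : forall (a : K) x, p (a *: x) = `|a| * p x }.

(* Completeness is that of the translation-invariant metric
   sum_k 2^-k min (1, p_k (x - y)), whose Cauchy sequences are the sequences
   that are Cauchy for every p_k. *)
Definition is_frechet (K : numFieldType) (X : topologicalLmodType K) : Prop :=
  exists p : nat -> X -> K,
    [/\ forall k, is_seminorm (p k),
        forall x, (forall k, p k x = 0) -> x = 0,
        forall (x : X) (U : set X), nbhs x U <->
          exists N : nat, exists2 eps : K, 0 < eps &
            [set y | forall k, (k <= N)%N -> p k (y - x) < eps] `<=` U &
        forall u : nat -> X,
          (forall k (eps : K), 0 < eps ->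
            \forall m & n \near \oo, p k (u m - u n) < eps) ->
          exists l : X, u @ \oo --> l].

(* The library's [lim] and [cvg] need a pointed type, which a
   [topologicalLmodType] is not. *)
Definition series_converges (K : numFieldType) (X : topologicalLmodType K)
    (u : nat -> X) : Prop :=
  exists l : X, series u @ \oo --> l.

Definition series_sum (K : numFieldType) (X : topologicalLmodType K)
    (u : nat -> X) : X :=
  xget 0 [set l : X | series u @ \oo --> l].

Definition expansion (K : numFieldType) (X : topologicalLmodType K)
    (e : nat -> X) (x : X) (a : nat -> K) : Prop :=
  series (fun n => a n *: e n) @ \oo --> x.

Definition is_basis (K : numFieldType) (X : topologicalLmodType K)
    (e : nat -> X) : Prop :=
  forall x : X, exists! a : nat -> K, expansion e x a.

Definition unconditional_basis (K : numFieldType) (X : topologicalLmodType K)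
    (e : nat -> X) : Prop :=
  is_basis e /\
  forall (x : X) (a : nat -> K), expansion e x a ->
    forall s : nat -> nat, bijective s -> expansion (e \o s) x (a \o s).

Definition coefficients (K : numFieldType) (X : topologicalLmodType K)
    (e : nat -> X) (x : X) : nat -> K :=
  xget (fun=> 0) [set a : nat -> K | expansion e x a].

(* Weight sequences (w_n)_(n >= 1) are functions on nat whose value at 0 is
   never used. *)
Definition weighted_shift_terms (K : numFieldType) (X : topologicalLmodType K)
    (e : nat -> X) (w : nat -> K) (x : X) : nat -> X :=
  fun n => (w n.+1 * coefficients e x n.+1) *: e n.

Definition weighted_shift (K : numFieldType) (X : topologicalLmodType K)
    (e : nat -> X) (w : nat -> K) (x : X) : X :=
  series_sum (weighted_shift_terms e w x).

Definition weighted_shift_is_operator (K : numFieldType)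
    (X : topologicalLmodType K) (e : nat -> X) (w : nat -> K) : Prop :=
  [/\ forall x : X, series_converges (weighted_shift_terms e w x),
      linear (weighted_shift e w) &
      continuous (weighted_shift e w)].

Definition upper_density (R : realType) (A : set nat) : \bar R :=
  limn_esup (fun n =>
    (#|[pred k : 'I_n.+1 | (k : nat) \in A]|%:R / n.+1%:R : R)%:E).

Definition upper_frequently_hypercyclic (R : realType) (X : topologicalType)
    (T : X -> X) (x : X) : Prop :=
  forall U : set X, open U -> U !=set0 ->
    (0 < upper_density R [set m | U (iter m T x)])%E.

Definition common_upper_frequently_hypercyclic (R : realType)
    (X : topologicalType) (I : Type) (D : set I) (T : I -> X -> X) : set X :=
  [set x | forall i, D i -> upper_frequently_hypercyclic R (T i) x].

Definition residual (X : topologicalType) (A : set X) : Prop :=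
  exists2 G : nat -> set X,
    (forall n, open (G n) /\ dense (G n)) & \bigcap_n G n `<=` A.

Definition compact_subinterval (R : realType) (Lambda K : set R) : Prop :=
  [/\ K !=set0, compact K, is_interval K & K `<=` Lambda].

(* Main.v *)
Require Import Defs.
From HB Require Import structures.
From mathcomp Require Import all_boot all_order all_algebra.
From mathcomp Require Import all_classical all_reals all_analysis.
From mathcomp Require Import complex.
From mathcomp Require Import ring lra zify.

(* Write [W_n(l) = w_1(l) ... w_n(l)] and let [S_l^m] be the m-th iterate of the
   natural right inverse of [B_l], so that [S_l^m e_k = W_k(l)/W_(k+m)(l) e_(k+m)].
   Fix a compact interval [[a, b]] and a finite combination y of the [e_k]. With p
   a large power of 2, consider the vectors x equal to a given finite combination
   plus the sum of the [S_(mu(q))^(pq) y], where [mu(q) = mu_j] for q in the window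
   [2^j <= q < 2^(j+1)] and [mu_j0 <= mu_(j0+1) <= ...] increases from a to b with
   steps proportional to [1 / sum_(i <= p 2^(j+1)) L_i(K)]; by (iv) finitely many
   windows suffice to reach b. If [mu_(j-1) < l <= mu_j] and q is in window j, then
   [B_l^(pq)] kills the terms before q, maps the q-th one close to y by (iii), and,
   as the weights increase and the parameters of the later terms are at least l, it
   maps those to a sum dominated by a tail of the series in (ii) at the parameter a.
   So [B_l^(pq) x] is close to y for all q in the window, a set of times whose
   density is bounded below independently of j. By Banach-Steinhaus the family
   [(B_l)_(a <= l <= b)] is equicontinuous, hence the same holds near x, and the
   Baire category theorem concludes. *)

Set Implicit Arguments.
Unset Strict Implicit.
Unset Printing Implicit Defensive.

Import Order.TTheory GRing.Theory Num.Theory.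
Import numFieldNormedType.Exports.

Local Open Scope classical_set_scope.
Local Open Scope ring_scope.

(** * Real and complex scalars in one setting *)

Section Scalars.
Variables (R : realType) (cplx : bool).
Implicit Types (x y : R) (a b : scalar_field R cplx).

(** Applied to nonnegative scalars only, where it inverts [of_real]. *)
Definition real_part a : R :=
  (if cplx as c return scalar_field R c -> R
   then @complex.Re R else id) a.

Definition real_abs a : R := real_part `|a|.

Lemma of_realD x y : of_real cplx (x + y) = of_real cplx x + of_real cplx y.
Proof. by case: (cplx); rewrite //= rmorphD. Qed.

Lemma of_realN x : of_real cplx (- x) = - of_real cplx x.
Proof. by case: (cplx); rewrite //= rmorphN. Qed.

Lemma of_realM x y : of_real cplx (x * y) = of_real cplx x * of_real cplx y.
Proof. by case: (cplx); rewrite //= rmorphM. Qed.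

Lemma of_real0 : of_real cplx (0 : R) = 0.
Proof. by case: (cplx); rewrite //= rmorph0. Qed.

Lemma of_real1 : of_real cplx (1 : R) = 1.
Proof. by case: (cplx); rewrite //= rmorph1. Qed.

Lemma ler_of_real x y : (of_real cplx x <= of_real cplx y) = (x <= y).
Proof. by case: (cplx); rewrite //= lecR. Qed.

Lemma of_real_inj : injective (@of_real R cplx).
Proof. by move=> x y exy; apply/eqP; rewrite eq_le -!ler_of_real exy !lexx. Qed.

Lemma ltr_of_real x y : (of_real cplx x < of_real cplx y) = (x < y).
Proof. by rewrite !lt_neqAle ler_of_real (inj_eq of_real_inj). Qed.

Lemma real_partK a : 0 <= a -> of_real cplx (real_part a) = a.
Proof.
rewrite /real_part; case: (cplx) a => //= -[u v].
by rewrite lecE /= => /andP[/eqP -> _].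
Qed.

Lemma of_real_abs a : of_real cplx (real_abs a) = `|a|.
Proof. exact: real_partK. Qed.

Lemma real_abs_ge0 a : 0 <= real_abs a.
Proof. by rewrite -ler_of_real of_real0 of_real_abs. Qed.

Lemma real_abs_of_real x : real_abs (of_real cplx x) = `|x|.
Proof.
apply: of_real_inj; rewrite of_real_abs.
case: (lerP 0 x) => x0.
  by rewrite !ger0_norm // -of_real0 ler_of_real.
by rewrite !ltr0_norm ?of_realN // -of_real0 ltr_of_real.
Qed.

Lemma real_absM a b : real_abs (a * b) = real_abs a * real_abs b.
Proof. by apply: of_real_inj; rewrite of_realM !of_real_abs normrM. Qed.

(** Rational, respectively Gaussian rational, numbers; they will be the coefficients of countably
    many target vectors. *)
Lemma countable_dense_scalars :
  exists D : nat -> scalar_field R cplx,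
    forall a (eps : R), 0 < eps -> exists n, real_abs (a - D n) < eps.
Proof.
have rat_approx x (eps : R) : 0 < eps -> exists q : rat, `|x - ratr q| < eps.
  move=> eps0; have [|q] := @rat_in_itvoo R (x - eps) (x + eps); first by lra.
  by rewrite in_itv /= => /andP[q1 q2]; exists q; rewrite ltr_norml; lra.
rewrite /real_abs /real_part; case: (cplx) => /=; last first.
  exists (fun n => ratr (odflt 0 (unpickle n))) => a eps /(rat_approx a)[q aq].
  by exists (pickle q); rewrite pickleK.
exists (fun n => let q := odflt (0, 0) (unpickle n) in
  (ratr q.1 +i* ratr q.2)%C) => -[u v] eps eps0.
have eps20 : 0 < eps / 2 by lra.
have [q1 uq1] := rat_approx u _ eps20; have [q2 vq2] := rat_approx v _ eps20.
exists (pickle (q1, q2)); rewrite pickleK /=.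
suff: Num.sqrt ((u - ratr q1) ^+ 2 + (v - ratr q2) ^+ 2) < eps by [].
rewrite -(ltr_pXn2r (n := 2)) ?nnegrE ?sqrtr_ge0 ?(ltW eps0) //.
rewrite sqr_sqrtr ?addr_ge0 ?sqr_ge0 //.
rewrite -[(u - _) ^+ 2]real_normK ?num_real //.
rewrite -[(v - _) ^+ 2]real_normK ?num_real //.
have := normr_ge0 (u - ratr q1); have := normr_ge0 (v - ratr q2).
by nra.
Qed.

End Scalars.

(** * Increasing sequences of real-valued seminorms *)

Record graded_seminorms (R : realType) (cplx : bool)
    (X : topologicalLmodType (scalar_field R cplx)) (P : nat -> X -> R) : Prop := {
  gradedD : forall n x y, P n (x + y) <= P n x + P n y ;
  gradedZ : forall n a x, P n (a *: x) = real_abs a * P n x ;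
  graded_le : forall n m x, (n <= m)%N -> P n x <= P m x ;
  graded_eq0 : forall x, (forall n, P n x = 0) -> x = 0 ;
  graded_nbhs : forall x U, nbhs x U <->
    exists n, exists2 eps, 0 < eps & [set y | P n (y - x) < eps] `<=` U ;
  graded_complete : forall u : nat -> X,
    (forall n (eps : R), 0 < eps -> exists N, forall i j, (N <= i)%N ->
       (N <= j)%N -> P n (u i - u j) < eps) ->
    exists l : X, u @ \oo --> l }.

(* Summing the first n+1 seminorms makes the family increasing, so that a single one
   controls each neighborhood. *)
Lemma frechet_graded_seminorms (R : realType) (cplx : bool)
    (X : topologicalLmodType (scalar_field R cplx)) :
  is_frechet X -> exists P : nat -> X -> R, graded_seminorms P.
Proof.
move=> [p [pS p_sep p_nbhs p_complete]].
pose r k x := real_part (p k x).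
have rE k x : of_real cplx (r k x) = p k x by apply/real_partK/seminorm_ge0.
have r_ge0 k x : 0 <= r k x.
  by rewrite -(ler_of_real cplx) of_real0 rE; apply: seminorm_ge0.
have le_r k n x : (k <= n)%N -> r k x <= \sum_(i < n.+1) r i x.
  move=> kn; rewrite (bigD1 (inord k)) //= inordK //.
  by rewrite ler_wpDr ?sumr_ge0.
exists (fun n x => \sum_(i < n.+1) r i x); split.
- move=> n x y; rewrite -big_split; apply: ler_sum => i _ /=.
  by rewrite -(ler_of_real cplx) of_realD !rE; apply: seminormD.
- move=> n a x; rewrite mulr_sumr; apply: eq_bigr => i _.
  by apply: (@of_real_inj _ cplx); rewrite of_realM !rE seminormZ // of_real_abs.
- move=> n m x nm; rewrite -!(big_mkord xpredT (r ^~ x)).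
  rewrite (@big_cat_nat _ _ _ n.+1 0%N m.+1) //=.
  by rewrite lerDl sumr_ge0.
- move=> x r0; apply: p_sep => k; rewrite -rE.
  suff -> : r k x = 0 by rewrite of_real0.
  by apply/eqP; rewrite eq_le r_ge0 -(r0 k) le_r.
- move=> x U; split.
    move=> /p_nbhs[N [eps eps0 NU]]; exists N, (real_part eps).
      by rewrite -(ltr_of_real cplx) of_real0 real_partK // ltW.
    move=> y /= yN; apply: NU => k kN /=.
    rewrite -rE -(real_partK (ltW eps0)) ltr_of_real.
    exact: le_lt_trans (le_r _ _ _ kN) yN.
  move=> [n [eps eps0 nU]]; apply/p_nbhs.
  exists n, (of_real cplx (eps / n.+1%:R)).
    by rewrite -(of_real0 R cplx) ltr_of_real divr_gt0.
  move=> y /= ny; apply: nU => /=.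
  apply: (@lt_le_trans _ _ (\sum_(i < n.+1) (eps / n.+1%:R))).
    apply: ltr_sum => [|i _]; first by apply/hasP; exists ord0; rewrite ?mem_index_enum.
    by rewrite -(ltr_of_real cplx) rE; apply: ny; rewrite -ltnS.
  by rewrite sumr_const card_ord -[leLHS]mulr_natr divfK ?pnatr_eq0.
- move=> u uC; apply: p_complete => k eps eps0.
  have [|N NP] := uC k (real_part eps).
    by rewrite -(ltr_of_real cplx) of_real0 real_partK // ltW.
  exists ([set n | (N <= n)%N], [set n | (N <= n)%N]); first by split; exists N.
  move=> [i j] [/= Ni Nj]; rewrite -rE -(real_partK (ltW eps0)) ltr_of_real.
  exact: le_lt_trans (le_r _ _ _ (leqnn k)) (NP _ _ Ni Nj).
Qed.

(** * Baire category and equicontinuity in Fréchet spaces *)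

Section GradedSeminorms.
Variables (R : realType) (cplx : bool).
Variables (X : topologicalLmodType (scalar_field R cplx)) (P : nat -> X -> R).
Hypothesis gP : graded_seminorms P.
Implicit Types (x y z l : X) (eps : R).

Lemma gradedZr n (c : R) x : P n (of_real cplx c *: x) = `|c| * P n x.
Proof. by rewrite (gradedZ gP) real_abs_of_real. Qed.

Lemma graded0 n : P n 0 = 0.
Proof. by rewrite -(scale0r 0) -(of_real0 R cplx) gradedZr normr0 mul0r. Qed.

Lemma gradedN n x : P n (- x) = P n x.
Proof.
by rewrite -scaleN1r -(of_real1 R cplx) -of_realN gradedZr normrN1 mul1r.
Qed.

Lemma graded_ge0 n x : 0 <= P n x.
Proof.
have := gradedD gP n x (- x); rewrite subrr graded0 gradedN.
lra.
Qed.

Lemma gradedB n x y : P n (x - y) <= P n x + P n y.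
Proof. by rewrite -(gradedN n y); exact: (gradedD gP). Qed.

Lemma graded_distC n x y : P n (x - y) = P n (y - x).
Proof. by rewrite -gradedN opprB. Qed.

Lemma graded_distD n y x z : P n (x - z) <= P n (x - y) + P n (y - z).
Proof. by rewrite -(subrKA y x (- z)); exact: (gradedD gP). Qed.

Lemma graded_sum n (I : Type) (r : seq I) (F : I -> X) :
  P n (\sum_(i <- r) F i) <= \sum_(i <- r) P n (F i).
Proof.
elim: r => [|i r IH]; first by rewrite !big_nil graded0.
by rewrite !big_cons (le_trans (gradedD gP _ _ _)) // lerD2l.
Qed.

Lemma graded_cvgP (u : nat -> X) l : u @ \oo --> l <->
  forall n eps, 0 < eps -> exists N, forall m, (N <= m)%N -> P n (u m - l) < eps.
Proof.
split=> [ul n eps eps0 | ul U /(graded_nbhs gP)[n [eps eps0 nU]]].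
  have /ul [N _ NP] : nbhs l [set y | P n (y - l) < eps].
    by apply/(graded_nbhs gP); exists n, eps.
  by exists N => m Nm; apply: NP.
by have [N NP] := ul n eps eps0; exists N => // m Nm; apply/nU/NP.
Qed.

Lemma graded_cvg_unique (u : nat -> X) l l' :
  u @ \oo --> l -> u @ \oo --> l' -> l = l'.
Proof.
move=> /graded_cvgP ul /graded_cvgP ul'; apply/subr0_eq/(graded_eq0 gP) => n.
apply/eqP; rewrite eq_le graded_ge0 andbT; apply/ler_addgt0Pr => eps eps0.
have eps20 : 0 < eps / 2 by lra.
have [N NP] := ul n _ eps20; have [N' NP'] := ul' n _ eps20.
have := graded_distD n (u (maxn N N')) l l'; rewrite (graded_distC n l (u _)).
have := NP _ (leq_maxl N N'); have := NP' _ (leq_maxr N N'); lra.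
Qed.

Lemma graded_cvg_le (u : nat -> X) l n x (c : R) N : u @ \oo --> l ->
  (forall m, (N <= m)%N -> P n (u m - x) <= c) -> P n (l - x) <= c.
Proof.
move=> /graded_cvgP ul uc; apply/ler_addgt0Pr => eps eps0.
have [N' NP] := ul n _ eps0.
have := graded_distD n (u (maxn N N')) l x; rewrite (graded_distC n l (u _)).
have := NP _ (leq_maxr N N'); have := uc _ (leq_maxl N N'); lra.
Qed.

Lemma graded_openP (U : set X) x : open U -> U x ->
  exists n, exists2 eps, 0 < eps & [set y | P n (y - x) < eps] `<=` U.
Proof. by move=> oU Ux; apply/(graded_nbhs gP)/open_nbhs_nbhs. Qed.

Lemma graded_ball_open n x eps : open [set y | P n (y - x) < eps].
Proof.
rewrite openE => y /= xy; apply/(graded_nbhs gP).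
exists n, (eps - P n (y - x)); first by rewrite subr_gt0.
by move=> z /=; have := graded_distD n y z x; lra.
Qed.

Lemma dense_ball (A : set X) :
  (forall x n eps, 0 < eps -> exists y, P n (y - x) < eps /\ A y) -> dense A.
Proof.
move=> dA O [x Ox] oO; have [n [eps eps0 nO]] := graded_openP oO Ox.
by have [y [/nO Oy Ay]] := dA x n eps eps0; exists y.
Qed.

(** Nested closed balls: the k-th lies in its predecessor and in [G k], with radius below 1/(k+1)
    and seminorm index at least k, so the centers form a Cauchy sequence whose limit lies in every
    ball. *)
Lemma graded_baire (G : nat -> set X) :
  (forall n, open (G n) /\ dense (G n)) -> dense (\bigcap_n G n).
Proof.
move=> Gd; apply: dense_ball => x n eps eps0.
(* A triple holds a center, a seminorm index and a radius. The guard on the radius makes [good]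
   solvable for every triple, as [choice] demands. *)
pose good (k : nat) (s s' : X * nat * R) := 0 < s.2 ->
  [/\ 0 < s'.2, s'.2 < k.+1%:R^-1, (k <= s'.1.2)%N &
   forall y, P s'.1.2 (y - s'.1.1) <= s'.2 ->
     P s.1.2 (y - s.1.1) < s.2 /\ G k y].
have step k s : exists s', good k s s'.
  case: s => -[y m] e; have [e0|e0] := ltP 0 e; last first.
    by exists (y, m, e) => /=; rewrite /good /= ltNge e0.
  have [oG dG] := Gd k.
  have := dG _ _ (graded_ball_open m y e).
  case; first by exists y; rewrite /= subrr graded0.
  move=> y' [/= yy' Gy'].
  have /graded_openP /(_ yy') := graded_ball_open m y e.
  move=> [m1 [e1 e10 s1]].
  have [m2 [e2 e20 s2]] := graded_openP oG Gy'.
  pose e3 := Num.min (Num.min e1 e2) k.+1%:R^-1.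
  have e30 : 0 < e3 by rewrite !lt_min e10 e20 invr_gt0 ltr0n.
  have [e31 e32 e3k] : [/\ e3 <= e1, e3 <= e2 & e3 <= k.+1%:R^-1].
    by rewrite !ge_min !lexx !orbT.
  (* Halving the radius fits the closed ball into the open ones. *)
  exists (y', maxn k (maxn m1 m2), e3 / 2) => _ /=.
  split; [lra | apply: lt_le_trans e3k; lra | exact: leq_maxl | move=> z z3].
  have mz i : (i <= maxn k (maxn m1 m2))%N -> P i (z - y') <= e3 / 2.
    by move=> /(graded_le gP) iz; apply: le_trans z3.
  split; [apply: s1 | apply: s2] => /=; apply: le_lt_trans (mz _ _) _;
    rewrite ?leq_max ?leqnn ?orbT //; lra.
have [f fP] := choice (fun ks => step ks.1 ks.2).
pose fix s k := if k is k'.+1 then f (k', s k') else (x, n, eps).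
have s0 k : 0 < (s k).2.
  by elim: k => [//|k IH] /=; have [] := fP (k, s k) IH.
pose B k := [set y | P (s k).1.2 (y - (s k).1.1) < (s k).2].
pose C k := [set y | P (s k.+1).1.2 (y - (s k.+1).1.1) <= (s k.+1).2].
have CB k : C k `<=` B k `&` G k.
  by move=> y Cy; have [_ _ _ /(_ y Cy)] := fP (k, s k) (s0 k).
have BC k : B k.+1 `<=` C k by move=> y /ltW.
have Bcenter k : B k (s k).1.1 by rewrite /B /= subrr graded0.
have BB k i : B (k + i)%N `<=` B k.
  elim: i => [|i IH]; first by rewrite addn0.
  by rewrite addnS => y /BC /CB[/IH].
have [l ul] : exists l, (fun k => (s k).1.1) @ \oo --> l.
  apply: (graded_complete gP) => k e e0.
  pose N := maxn k (Num.truncn (e / 2)^-1).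
  exists N.+1 => i j /subnKC <- /subnKC <-.
  have [_ sN kN _] := fP (N, s N) (s0 N).
  have Ne : N.+1%:R^-1 < e / 2.
    rewrite invf_plt ?posrE ?ltr0n //; last by lra.
    apply: (lt_le_trans (truncnS_gt _)); rewrite ler_nat ltnS leq_maxr //.
  have BN i' : P k ((s (N.+1 + i')%N).1.1 - (s N.+1).1.1) < e / 2.
    apply: le_lt_trans (graded_le gP _ (leq_trans _ kN) ) _; first exact: leq_maxl.
    by apply: lt_trans Ne; apply: lt_trans sN; exact: (BB N.+1 i' _ (Bcenter _)).
  have := graded_distD k (s N.+1).1.1 (s (N.+1 + (i - N.+1))%N).1.1
    (s (N.+1 + (j - N.+1))%N).1.1.
  rewrite (graded_distC k (s N.+1).1.1).
  have := BN (i - N.+1)%N; have := BN (j - N.+1)%N; lra.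
have Cl k : C k l.
  apply: (graded_cvg_le (N := k.+1)) ul _ => i /subnKC <-.
  by apply/ltW; exact: (BB k.+1 _ _ (Bcenter _)).
exists l; split; first by have [] := CB _ _ (Cl 0%N).
by move=> k _; have [] := CB _ _ (Cl k).
Qed.

Section EquicontinuousFamily.
Variables (I : Type) (D : set I) (T : I -> X -> X).
Hypothesis T_linear : forall i, D i -> linear (T i).

Lemma familyD i x y : D i -> T i (x + y) = T i x + T i y.
Proof. by move=> /T_linear/(_ 1 x y); rewrite !scale1r. Qed.

Lemma family0 i : D i -> T i 0 = 0.
Proof.
by move=> Di; apply: (@addrI _ (T i 0)); rewrite -familyD // !addr0.
Qed.

Lemma familyZ i a x : D i -> T i (a *: x) = a *: T i x.
Proof.
by move=> Di; have := T_linear Di a x 0; rewrite !addr0 family0 // addr0.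
Qed.

Lemma family_sum i J (r : seq J) (F : J -> X) : D i ->
  T i (\sum_(j <- r) F j) = \sum_(j <- r) T i (F j).
Proof.
move=> Di; elim: r => [|j r IH]; first by rewrite !big_nil family0.
by rewrite !big_cons familyD // IH.
Qed.

Lemma iter_linear i m : D i -> linear (iter m (T i)).
Proof. by move=> Di; elim: m => [//|m IH] a x y /=; rewrite IH T_linear. Qed.

Hypothesis T_continuous : forall i, D i -> continuous (T i).
Hypothesis T_bounded : forall z n, exists C, forall i, D i -> P n (T i z) <= C.

(** If all the open sets [G k] were dense, a point common to them would contradict [T_bounded]. So
    some ball V misses some [G k], which bounds the whole family by k on V. *)
Lemma graded_banach_steinhaus n eps : 0 < eps -> exists m, exists2 delta,
  0 < delta & forall z i, P m z < delta -> D i -> P n (T i z) < eps.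
Proof.
move=> eps0.
pose G (k : nat) := [set z | exists2 i, D i & k%:R < P n (T i z)].
have oG k : open (G k).
  rewrite openE => z [i Di kz].
  have e0 : 0 < P n (T i z) - k%:R by rewrite subr_gt0.
  have : nbhs (T i z) [set y | P n (y - T i z) < P n (T i z) - k%:R].
    by apply/(graded_nbhs gP); exists n, (P n (T i z) - k%:R).
  move=> /(T_continuous Di)/(graded_nbhs gP)[n' [e' e'0 zG]].
  apply/(graded_nbhs gP); exists n', e' => // y /zG /= yz; exists i => //.
  have := gradedD gP n (T i y) (T i z - T i y).
  by rewrite subrKC (graded_distC _ (T i z)); lra.
have [k /existsNP[V /not_implyP[[x Vx] /not_implyP[oV VG]]]] :
    exists k, ~ dense (G k).
  apply/existsNP => dG.
  have T0 : [set: X] !=set0 by exists 0.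
  have [z [_ zG]] := graded_baire (fun k => conj (oG k) (dG k)) T0 openT.
  have [C CP] := T_bounded z n.
  have [i Di] := zG (Num.truncn C).+1 Logic.I.
  by have := CP i Di; have := truncnS_gt C; lra.
have VG' y i : V y -> D i -> P n (T i y) <= k%:R.
  move=> Vy Di; rewrite leNgt; apply/negP => ky.
  by apply: VG; exists y; split=> //; exists i.
have [m [delta delta0 mV]] := graded_openP oV Vx.
(* Both x and x + c z lie in V, so c [P n (T i z)] is at most 2k, which is less than c eps =
   2(k+1). *)
pose c : R := (2 * k.+1%:R) / eps.
have k0 : (0 : R) < k.+1%:R by rewrite ltr0n.
have c0 : 0 < c by rewrite divr_gt0 // mulr_gt0.
exists m, (delta / c); first by rewrite divr_gt0.
move=> z i zd Di.
have xz : V (x + of_real cplx c *: z).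
  apply: mV => /=; rewrite addrC addKr gradedZr gtr0_norm //.
  by rewrite mulrC -ltr_pdivlMr.
have := gradedB n (T i (x + of_real cplx c *: z)) (T i x).
have := VG' _ _ xz Di; have := VG' _ _ Vx Di.
rewrite familyD // familyZ // (addrC (T i x)) addrK gradedZr gtr0_norm // => h1 h2 h3.
have : c * P n (T i z) < c * eps.
  have -> : c * eps = 2 * k%:R + 2.
    by rewrite /c divfK ?gt_eqF // -[k.+1]addn1 natrD; lra.
  lra.
by rewrite ltr_pM2l.
Qed.

(** Makes finitely many visits survive a perturbation of the vector, uniformly in the parameter. *)
Lemma graded_equicontinuous_iter M n eps : 0 < eps -> exists k, exists2 delta,
  0 < delta & forall z i m, P k z < delta -> D i -> (m <= M)%N ->
    P n (iter m (T i) z) < eps.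
Proof.
elim: M n eps => [|M IH] n eps eps0.
  by exists n, eps => // z i m zn Di; rewrite leqn0 => /eqP ->.
have [k [d d0 kP]] := graded_banach_steinhaus n eps0.
have [k' [d' d'0 kP']] := IH k _ d0.
exists (maxn n k'), (Num.min eps d'); first by rewrite lt_min eps0.
move=> z i [|m] /=; rewrite lt_min => /andP[z1 z2] Di mM.
  exact: le_lt_trans (graded_le gP _ (leq_maxl _ _)) z1.
apply: kP => //; apply: kP' => //.
exact: le_lt_trans (graded_le gP _ (leq_maxr _ _)) z2.
Qed.

End EquicontinuousFamily.

End GradedSeminorms.

(** * Tails of unconditionally convergent series *)

Section UnconditionalConvergence.
Variables (R : realType) (cplx : bool).
Variables (X : topologicalLmodType (scalar_field R cplx)) (P : nat -> X -> R).
Hypothesis gP : graded_seminorms P.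

(** The seminorm is convex in each multiplier, so it is largest when all of them are 0 or 1, that
    is, on a subsum. *)
Lemma convex_multipliers n (J : eqType) (s : seq J) (u : J -> X) (C : R)
    (c : J -> R) :
  (forall t, subseq t s -> P n (\sum_(j <- t) u j) <= C) ->
  {in s, forall j, 0 <= c j <= 1} ->
  P n (\sum_(j <- s) of_real cplx (c j) *: u j) <= C.
Proof.
move=> sC s01.
(* The shift z collects the terms whose multiplier has been replaced by 1, which the induction
   needs. *)
suff shifted z : (forall t, subseq t s -> P n (z + \sum_(j <- t) u j) <= C) ->
    P n (z + \sum_(j <- s) of_real cplx (c j) *: u j) <= C.
  by rewrite -[\sum_(j <- s) _]add0r shifted // => t /sC; rewrite add0r.
elim: s s01 z {sC} => [|j s IH] s01 z zC.
  by have := zC [::] isT; rewrite !big_nil.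
have /andP[c0 c1] : 0 <= c j <= 1 by rewrite s01 // mem_head.
have {}s01 : {in s, forall j, 0 <= c j <= 1}.
  by move=> i si; rewrite s01 // inE si orbT.
have IH0 := IH s01 z (fun t ts => zC t (subseq_trans ts (subseq_cons s j))).
have IH1 : P n (z + u j + \sum_(j <- s) of_real cplx (c j) *: u j) <= C.
  apply: IH => // t ts; have := zC (j :: t); rewrite big_cons addrA; apply.
  by rewrite /= eqxx.
rewrite big_cons; set S := \sum_(j <- s) _ in IH0 IH1 *.
have -> : z + (of_real cplx (c j) *: u j + S) =
    of_real cplx (1 - c j) *: (z + S) + of_real cplx (c j) *: (z + u j + S).
  rewrite [z + u j + S]addrAC (scalerDr _ (z + S)) [RHS]addrA -scalerDl.
  by rewrite -of_realD subrK of_real1 scale1r -addrA [S + _]addrC.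
apply: le_trans (gradedD gP _ _ _) _; rewrite !(gradedZr gP).
rewrite (ger0_norm c0) ger0_norm ?subr_ge0 //.
by nra.
Qed.

(* [nat] is cut into consecutive blocks [N, block_end N) with [F N] inside the
   block of N. [block_perm] lists [F N] first in its block, so that each
   [\sum_(i <- F N) v i] is a difference of partial sums of the rearranged series. *)
Section BlockRearrangement.
Variable F : nat -> seq nat.
Hypothesis F_uniq : forall N, uniq (F N).
Hypothesis F_ge : forall N i, i \in F N -> (N <= i)%N.

Definition block_end N := (\max_(i <- N :: F N) i).+1.

(** The left end of the block containing n; the first block starts at 0, and each later one where
    its predecessor ends. *)
Fixpoint block_start n :=
  if n is n'.+1 then
    if n'.+1 == block_end (block_start n') then n'.+1 else block_start n'
  else 0%N.

Definition block N := F N ++ [seq i <- iota N (block_end N - N) | i \notin F N].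

Lemma block_end_gt N i : i \in N :: F N -> (i < block_end N)%N.
Proof. by move=> iF; rewrite ltnS; apply: leq_bigmax_seq. Qed.

Lemma block_start_le n : (block_start n <= n)%N.
Proof. by elim: n => [//|n IH] /=; case: ifP => // _; apply: leqW. Qed.

Lemma lt_block_end n : (n < block_end (block_start n))%N.
Proof.
elim: n => [//|n IH] /=; case: ifP => [_|/negbT ne].
  by rewrite block_end_gt ?mem_head.
by rewrite ltn_neqAle ne.
Qed.

Lemma block_startE n m : (block_start n <= m < block_end (block_start n))%N ->
  block_start m = block_start n.
Proof.
have up k i : (k + i < block_end (block_start k))%N ->
    block_start (k + i) = block_start k.
  elim: i => [|i IH]; first by rewrite addn0.
  move=> ki; rewrite addnS /= IH; last by apply: ltnW; rewrite -addnS.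
  by rewrite -addnS ltn_eqF.
have idem k : block_start (block_start k) = block_start k.
  by elim: k => [//|k IH] /=; case: ifP => //= ->.
by move=> /andP[/subnKC <- mn]; rewrite up idem.
Qed.

Lemma mem_block N i : (i \in block N) = (N <= i < block_end N)%N.
Proof.
rewrite mem_cat mem_filter mem_iota subnKC; last first.
  by apply/ltnW/block_end_gt/mem_head.
case iF: (i \in F N) => //=; rewrite (F_ge iF) block_end_gt //.
by rewrite inE iF orbT.
Qed.

Lemma block_uniq N : uniq (block N).
Proof.
rewrite cat_uniq F_uniq filter_uniq ?iota_uniq // andbT.
by apply/hasPn => i; rewrite mem_filter => /andP[].
Qed.

Lemma size_block N : size (block N) = (block_end N - N)%N.
Proof.
rewrite -[RHS](size_iota N); apply/perm_size/uniq_perm.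
- exact: block_uniq.
- exact: iota_uniq.
- move=> i; rewrite mem_block mem_iota subnKC //.
  by apply/ltnW/block_end_gt/mem_head.
Qed.

Definition block_perm n := nth 0%N (block (block_start n)) (n - block_start n).

Lemma block_perm_bij : bijective block_perm.
Proof.
(* The rearrangement preserves each block, so it is inverted by looking up n in the list of its own
   block. *)
pose inv n := (block_start n + index n (block (block_start n)))%N.
have n_block n : (n - block_start n < size (block (block_start n)))%N.
  by rewrite size_block ltn_sub2r ?lt_block_end // block_end_gt ?mem_head.
exists inv => n; rewrite /inv /block_perm.
- have pn := mem_nth 0%N (n_block n).
  rewrite (_ : block_start (nth _ _ _) = block_start n); last first.
    by apply: block_startE; rewrite -mem_block.
  by rewrite index_uniq ?block_uniq // subnKC ?block_start_le.
- have nb : n \in block (block_start n).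
    by rewrite mem_block block_start_le lt_block_end.
  have -> : block_start (block_start n + index n (block (block_start n))) =
      block_start n.
    apply: block_startE; rewrite leq_addr -ltn_subRL -size_block index_mem //.
  by rewrite addKn nth_index.
Qed.

(** The end of the block containing N starts a new block, whose list begins with its [F]. *)
Lemma block_perm_infinite N : exists2 n, (N <= n)%N &
  [seq block_perm i | i <- iota n (size (F n))] = F n.
Proof.
exists (block_end (block_start N)); first exact/ltnW/lt_block_end.
set n := block_end _.
have sn : block_start n = n.
  have nE : n = n.-1.+1 by [].
  rewrite nE /= (_ : block_start n.-1 = block_start N) ?eqxx //.
  apply: block_startE; rewrite -ltnS -nE leqnn andbT.
  by rewrite block_end_gt ?mem_head.
apply: (@eq_from_nth _ 0%N); rewrite size_map size_iota // => i iF.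
rewrite (nth_map 0%N) ?size_iota // nth_iota // /block_perm.
have -> : block_start (n + i) = n.
  rewrite -[RHS]sn; apply: block_startE; rewrite sn leq_addr /=.
  rewrite -ltn_subRL -size_block size_cat; exact: ltn_addr.
by rewrite addKn nth_cat iF.
Qed.

End BlockRearrangement.

(** Otherwise beyond every N there is a finite set [F N] with a large sum; the block rearrangement
    makes infinitely many of these sets contiguous, and its partial sums are not Cauchy. *)
Lemma unconditional_tail (v : nat -> X) n (eps : R) : 0 < eps ->
  (forall s, bijective s -> exists l : X, series (v \o s) @ \oo --> l) ->
  exists N, forall t, uniq t -> (forall i, i \in t -> (N <= i)%N) ->
    P n (\sum_(i <- t) v i) < eps.
Proof.
move=> eps0 v_cvg; apply: contrapT => /forallNP no_tail.
have /choice[F FP] : forall N, exists t : seq nat,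
    [/\ uniq t, forall i, i \in t -> (N <= i)%N &
        eps <= P n (\sum_(i <- t) v i)].
  move=> N; have /existsNP[t /not_implyP[ut /not_implyP[tN /negP]]] := no_tail N.
  by rewrite -leNgt; exists t.
have F_uniq N : uniq (F N) by have [] := FP N.
have F_ge N i : i \in F N -> (N <= i)%N by have [_ + _] := FP N; apply.
have [l /(graded_cvgP gP) ul] := v_cvg _ (block_perm_bij F_uniq F_ge).
have eps20 : 0 < eps / 2 by lra.
have [N NP] := ul n _ eps20.
have [m Nm mF] := block_perm_infinite F_uniq F_ge N.
have [_ _] := FP m; rewrite -{}mF big_map.
set S := series _ in NP.
have -> : \sum_(i <- iota m (size (F m))) v (block_perm F i) =
    S (m + size (F m))%N - S m.
  by rewrite /S sub_series_geq ?leq_addr // /index_iota addKn.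
have := graded_distD gP n l (S (m + size (F m))%N) (S m).
rewrite (graded_distC gP n l (S m)).
have := NP _ Nm; have := NP _ (leq_trans Nm (leq_addr (size (F m)) m)); lra.
Qed.

(** The reindexing [g] allows for the positions that copies occupy after a shift. *)
Lemma unconditional_tail_multipliers (v : nat -> X) n (eps : R) : 0 < eps ->
  (forall s, bijective s -> exists l : X, series (v \o s) @ \oo --> l) ->
  exists N, forall (t : seq nat) (g : nat -> nat) (c : nat -> R),
    uniq [seq g i | i <- t] -> {in t, forall i, N <= g i}%N ->
    {in t, forall i, 0 <= c i <= 1} ->
    P n (\sum_(i <- t) of_real cplx (c i) *: v (g i)) <= eps.
Proof.
move=> eps0 /(unconditional_tail n eps0)[N NP]; exists N => t g c ut tN.
apply: convex_multipliers => t' tt'; rewrite -(big_map g xpredT v) ltW // NP //.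
  by apply: subseq_uniq ut; apply: map_subseq.
by move=> _ /mapP[i /(mem_subseq tt') it ->]; apply: tN.
Qed.

End UnconditionalConvergence.

(** * Weighted shifts *)

Section BasisExpansions.
Variables (R : realType) (cplx : bool).
Variables (X : topologicalLmodType (scalar_field R cplx)) (P : nat -> X -> R).
Hypothesis gP : graded_seminorms P.
Variable e : nat -> X.
Hypothesis e_basis : is_basis e.

Lemma expansion_coefficients x : expansion e x (coefficients e x).
Proof.
have [a [ea _]] := e_basis x.
by apply: (@xgetPex _ _ [set a | expansion e x a]); exists a.
Qed.

Lemma coefficientsE x a : expansion e x a -> coefficients e x = a.
Proof.
move=> ea; have [b [_ b_uniq]] := e_basis x.
by rewrite -(b_uniq _ ea); apply/esym/b_uniq/expansion_coefficients.
Qed.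

Lemma cvg_series_eventually0 (u : nat -> X) N :
  (forall n, (N <= n)%N -> u n = 0) -> series u @ \oo --> series u N.
Proof.
move=> u0; apply/(graded_cvgP gP) => n eps eps0; exists N => m Nm.
rewrite sub_series_geq // big_nat big1 ?(graded0 gP) // => i /andP[Ni _].
exact: u0.
Qed.

Lemma expansion_basis k : expansion e (e k) (fun n => (n == k)%:R).
Proof.
have := @cvg_series_eventually0 (fun n => (n == k)%:R *: e n) k.+1.
rewrite {2}/series /= big_nat_recr //= eqxx scale1r big_nat big1 ?add0r.
  by apply => n /gtn_eqF ->; rewrite scale0r.
by move=> i /ltn_eqF ->; rewrite scale0r.
Qed.

Lemma weighted_shift_expansion (w : nat -> scalar_field R cplx) x :
  weighted_shift_is_operator e w ->
  expansion e (weighted_shift e w x) (fun n => w n.+1 * coefficients e x n.+1).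
Proof.
by move=> [/(_ x) [l lx] _ _];
  apply: (@xgetPex _ _ [set l | series (weighted_shift_terms e w x) @ \oo --> l]);
  exists l.
Qed.

Lemma weighted_shift_basis (w : nat -> scalar_field R cplx) k :
  weighted_shift_is_operator e w ->
  weighted_shift e w (e k) = if k is j.+1 then w k *: e j else 0.
Proof.
move=> /(@weighted_shift_expansion _ (e k)).
rewrite (coefficientsE (@expansion_basis k)) => ek.
apply: (graded_cvg_unique gP ek).
have := @cvg_series_eventually0 (fun n => (w n.+1 * (n.+1 == k)%:R) *: e n) k.
set l := series _ k; have -> : l = if k is j.+1 then w k *: e j else 0.
  rewrite /l; case: (k) => [|j]; first by rewrite /series /= big_geq.
  rewrite /series /= big_nat_recr //= eqxx mulr1 big_nat big1 ?add0r //.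
  by move=> i /ltn_eqF; rewrite eqSS => ->; rewrite mulr0 scale0r.
by apply=> n kn; rewrite gtn_eqF // mulr0 scale0r.
Qed.

End BasisExpansions.

(** * Families of shifts with increasing weights *)

Definition weight_prod (R : realType) (w : nat -> R -> R) (l : R) (n : nat) : R :=
  \prod_(1 <= i < n.+1) w i l.

Definition shift_at (R : realType) (cplx : bool)
    (X : topologicalLmodType (scalar_field R cplx)) (e : nat -> X)
    (w : nat -> R -> R) (l : R) : X -> X :=
  weighted_shift e (fun n => of_real cplx (w n l)).

Section WeightedShiftFamily.
Variables (R : realType) (cplx : bool) (Lambda : set R).
Variables (X : topologicalLmodType (scalar_field R cplx)) (P : nat -> X -> R).
Hypothesis gP : graded_seminorms P.
Variable e : nat -> X.
Hypothesis e_basis : unconditional_basis e.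
Variable w : nat -> R -> R.
Hypothesis w_gt0 : forall n l, (1 <= n)%N -> Lambda l -> 0 < w n l.
Hypothesis B_operator : forall l, Lambda l ->
  weighted_shift_is_operator e (fun n => of_real cplx (w n l)).
Hypothesis w_increasing : forall n, (1 <= n)%N ->
  forall l m, Lambda l -> Lambda m -> l <= m -> w n l <= w n m.

Local Notation B := (shift_at e w).
Local Notation W := (weight_prod w).

Lemma B_linear l : Lambda l -> linear (B l).
Proof. by move=> /B_operator[]. Qed.

Lemma iter_B_linear m l : Lambda l -> linear (iter m (B l)).
Proof. by apply: iter_linear => j; apply: B_linear. Qed.

Lemma weight_prodS l n : W l n.+1 = W l n * w n.+1 l.
Proof. by rewrite /weight_prod big_nat_recr. Qed.

Lemma weight_prod_gt0 l n : Lambda l -> 0 < W l n.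
Proof.
move=> Ll; rewrite /weight_prod big_nat; apply: prodr_gt0 => i /andP[i1 _].
exact: w_gt0.
Qed.

(** The ratio is [w_(k+1) ... w_n], and each factor increases with the parameter. *)
Lemma weight_prod_ratio_le l m k n : Lambda l -> Lambda m -> l <= m ->
  (k <= n)%N -> W l n / W l k <= W m n / W m k.
Proof.
move=> Ll Lm lm /subnKC <-; elim: (n - k)%N => [|i IH].
  by rewrite addn0 !divff ?gt_eqF ?weight_prod_gt0.
rewrite addnS !weight_prodS ![_ * w _ _ / _]mulrAC.
apply: ler_pM => //; last exact: w_increasing.
- by rewrite divr_ge0 ?ltW ?weight_prod_gt0.
- by rewrite ltW ?w_gt0.
Qed.

Lemma iter_B_basis l k m : Lambda l ->
  iter m (B l) (e (k + m)) = of_real cplx (W l (k + m) / W l k) *: e k.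
Proof.
move=> Ll; elim: m => [|m IH].
  by rewrite addn0 divff ?gt_eqF ?weight_prod_gt0 // of_real1 scale1r.
rewrite iterSr addnS [B l (e _)](weighted_shift_basis gP e_basis.1 _ (B_operator Ll)).
rewrite (familyZ (iter_B_linear m)) //.
by rewrite IH scalerA -of_realM weight_prodS [_ * w _ _ / _]mulrAC mulrC.
Qed.

Lemma iter_B_basis0 l k m : Lambda l -> (k < m)%N -> iter m (B l) (e k) = 0.
Proof.
move=> Ll /subnK <-; rewrite iterD iterS -[X in e X]add0n iter_B_basis //.
rewrite (familyZ B_linear) //.
rewrite [B l (e _)](weighted_shift_basis gP e_basis.1 _ (B_operator Ll)).
by rewrite scaler0 (family0 (iter_B_linear _)).
Qed.

(** The pointwise bound for Banach-Steinhaus. The terms of [B l z] are those of [B b z] times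
    factors [w_i(l) / w_i(b)] in [0, 1]: the first N are bounded one by one, the others by the
    unconditional tail. *)
Lemma B_bounded a b z n : Lambda a -> Lambda b ->
  exists C, forall l, Lambda l /\ a <= l <= b -> P n (B l z) <= C.
Proof.
move=> La Lb; pose v i := (of_real cplx (w i.+1 b) * coefficients e z i.+1) *: e i.
have v_cvg s : bijective s -> exists l : X, series (v \o s) @ \oo --> l.
  move=> bs; exists (B b z).
  exact: e_basis.2 (@weighted_shift_expansion _ _ _ e _ z (B_operator Lb)) s bs.
have [N NP] := unconditional_tail_multipliers gP n ltr01 v_cvg.
exists (\sum_(0 <= i < N) P n (v i) + 1) => l [Ll /andP[al lb]].
pose c i := w i.+1 l / w i.+1 b.
have c01 i : 0 <= c i <= 1.
  have w0 x : Lambda x -> 0 < w i.+1 x by exact: w_gt0.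
  by rewrite /c ler_pdivrMr ?w0 // mul1r w_increasing // divr_ge0 // ltW // w0.
rewrite -[B l z]subr0.
apply: (graded_cvg_le gP (N := N)
  (@weighted_shift_expansion _ _ _ e _ z (B_operator Ll))).
move=> m Nm; rewrite subr0 /series /= (@big_cat_nat _ _ _ N) //=.
have cE i : (of_real cplx (w i.+1 l) * coefficients e z i.+1) *: e i =
    of_real cplx (c i) *: v i.
  rewrite /v scalerA mulrA -of_realM /c divfK // gt_eqF //; exact: w_gt0.
apply: le_trans (gradedD gP _ _ _) _; apply: lerD.
  apply: le_trans (graded_sum gP _ _ _) _; apply: ler_sum => i _.
  rewrite cE (gradedZr gP) ger0_norm; last by case/andP: (c01 i).
  by rewrite ler_piMl ?(graded_ge0 gP) //; case/andP: (c01 i).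
rewrite (eq_bigr _ (fun i _ => cE i)); apply: (NP _ id).
- by rewrite map_id iota_uniq.
- by move=> i; rewrite mem_index_iota => /andP[].
- by move=> i _; apply: c01.
Qed.

(** * Preimages of a finite combination under iterated shifts *)

Section Copies.
Variables (alpha : nat -> scalar_field R cplx) (d : nat).

(* The natural preimage of [\sum_(k < d) alpha k *: e k] under [iter m (B mu)]. *)
Definition shifted_copy mu m : X :=
  \sum_(k < d) (alpha k * of_real cplx (W mu k / W mu (k + m))) *: e (k + m).

Lemma iter_B_copy l mu m t : Lambda l ->
  iter m (B l) (shifted_copy mu (m + t)) =
  \sum_(k < d) (alpha k * of_real cplx (W mu k / W mu (k + (m + t)) *
     (W l (k + (m + t)) / W l (k + t)))) *: e (k + t).
Proof.
move=> Ll.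
rewrite /shifted_copy (family_sum (iter_B_linear m)) //; apply: eq_bigr => k _.
rewrite (familyZ (iter_B_linear m)) // [(m + t)%N]addnC addnA iter_B_basis // scalerA.
by rewrite [in RHS](of_realM _ (_ / _) (W l _ / _)) [in RHS]mulrA.
Qed.

Lemma iter_B_copy0 l mu m m' : Lambda l -> (d + m' <= m)%N ->
  iter m (B l) (shifted_copy mu m') = 0.
Proof.
move=> Ll dm.
rewrite /shifted_copy (family_sum (iter_B_linear m)) // big1 // => k _.
rewrite (familyZ (iter_B_linear m)) // iter_B_basis0 ?scaler0 //.
by apply: leq_trans dm; rewrite ltn_add2r.
Qed.

(** As [a <= l <= mu q], monotonicity bounds the coefficients left after m shifts by those of the
    series (ii) at a, up to the fixed factors [alpha k * W a k]. The case m = 0 bounds the copies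
    themselves. *)
Lemma iter_B_copies_small a n eps : Lambda a -> 0 < eps ->
  (exists y : X, (\sum_(1 <= v < N) of_real cplx (W a v)^-1 *: e v)
     @[N --> \oo] --> y) ->
  exists N, forall (t : seq nat) (pos : nat -> nat) (mu : nat -> R) l m,
    Lambda l -> a <= l -> uniq t -> injective pos ->
    {in t, forall q, Lambda (mu q) /\ l <= mu q} ->
    {in t, forall q, m + N <= pos q}%N ->
    P n (iter m (B l) (\sum_(q <- t) shifted_copy (mu q) (pos q))) <= eps.
Proof.
move=> La eps0 [y ya].
pose v i := of_real cplx (W a i)^-1 *: e i.
have v_cvg s : bijective s -> exists l : X, series (v \o s) @ \oo --> l.
  move=> bs; exists (e 0%N + y).
  (* The series (ii) starts at 1; its missing term is [e 0], since the empty product is 1. *)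
  suff ea : expansion e (e 0%N + y) (fun i => of_real cplx (W a i)^-1).
    exact: e_basis.2 ea s bs.
  apply/(graded_cvgP gP) => k r r0.
  have [N NP] := (graded_cvgP gP _ _).1 ya k r r0.
  exists N.+1 => [[//|m]] /ltnW Nm; rewrite /series /=.
  rewrite big_ltn // {1}/weight_prod big_geq // invr1 of_real1 scale1r.
  rewrite opprD addrACA subrr add0r.
  exact: NP.
(* Total size of the fixed factors; dividing by 1 + A below avoids a zero denominator. *)
pose A := \sum_(k < d) real_abs (alpha k) * W a k.
have A0 : 0 <= A.
  by apply: sumr_ge0 => k _; rewrite mulr_ge0 ?real_abs_ge0 ?ltW ?weight_prod_gt0.
have epsA : 0 < eps / (1 + A) by rewrite divr_gt0 //; lra.
have [N NP] := unconditional_tail_multipliers gP n epsA v_cvg.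
exists N => t pos mu l m Ll al ut pos_inj mut post.
have m_le q : q \in t -> (m <= pos q)%N.
  by move=> /post; apply: leq_trans; apply: leq_addr.
(* The actual coefficient divided by the one at parameter a. The comparison of l with [mu q] ([h1])
   and of a with l ([h2]) give [c k q <= 1]. *)
pose c k q := (W (mu q) k / W (mu q) (k + pos q) *
  (W l (k + pos q) / W l (k + (pos q - m)))) / (W a k / W a (k + (pos q - m))).
have c01 k q : q \in t -> 0 <= c k q <= 1.
  move=> qt; have [Lm lm] := mut q qt.
  have W0 x i : Lambda x -> 0 < W x i by exact: weight_prod_gt0.
  have W0' x i : Lambda x -> 0 <= W x i by move=> Lx; rewrite ltW ?W0.
  apply/andP; split; first by rewrite !(divr_ge0, mulr_ge0) ?W0'.
  rewrite /c ler_pdivrMr ?divr_gt0 ?W0 // mul1r.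
  have h1 := weight_prod_ratio_le Ll Lm lm (leq_addr (pos q) k).
  have h2 := weight_prod_ratio_le La Ll al (leq_addr (pos q - m) k).
  have -> : W (mu q) k / W (mu q) (k + pos q) = (W (mu q) (k + pos q) / W (mu q) k)^-1.
    by rewrite invf_div.
  have -> : W l (k + pos q) / W l (k + (pos q - m)) =
      (W l (k + pos q) / W l k) / (W l (k + (pos q - m)) / W l k).
    by rewrite invf_div mulrA divfK // gt_eqF ?W0.
  have -> : W a k / W a (k + (pos q - m)) = (W a (k + (pos q - m)) / W a k)^-1.
    by rewrite invf_div.
  rewrite mulrA; apply: (@le_trans _ _ (W l (k + (pos q - m)) / W l k)^-1).
    rewrite ler_piMl ?invr_ge0 ?divr_ge0 ?W0' // mulrC.
    by rewrite ler_pdivrMr ?mul1r ?divr_gt0 ?W0.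
  by rewrite lef_pV2 ?posrE ?divr_gt0 ?W0.
rewrite (family_sum (iter_B_linear m)) //.
(* For fixed k the vectors in the inner sum have distinct indices, so each inner sum is a tail with
   multipliers. *)
have -> : \sum_(q <- t) iter m (B l) (shifted_copy (mu q) (pos q)) =
    \sum_(k < d) (alpha k * of_real cplx (W a k)) *:
       \sum_(q <- t) of_real cplx (c k q) *: v (k + (pos q - m))%N.
  under [RHS]eq_bigr do rewrite scaler_sumr.
  rewrite [RHS]exchange_big; apply: eq_big_seq => q qt /=.
  have := iter_B_copy (mu q) m (pos q - m) Ll; rewrite subnKC ?m_le // => ->.
  apply: eq_bigr => k _; rewrite /v !scalerA; congr (_ *: _); rewrite -!mulrA.
  rewrite -(of_realM cplx (c k q)) -(of_realM cplx (W a k)); congr (_ * of_real _ _).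
  have Wn0 x i : Lambda x -> W x i != 0 by move=> Lx; rewrite gt_eqF ?weight_prod_gt0.
  have [Lmu _] := mut q qt.
  by rewrite /c; field; rewrite !Wn0.
apply: le_trans (graded_sum gP _ _ _) _.
apply: (@le_trans _ _ (A * (eps / (1 + A)))); last first.
  by rewrite mulrCA ler_piMr ?(ltW eps0) // ler_pdivrMr; lra.
rewrite /A mulr_suml; apply: ler_sum => k _; rewrite (gradedZ gP).
have -> : real_abs (alpha k * of_real cplx (W a k)) = real_abs (alpha k) * W a k.
  by rewrite real_absM real_abs_of_real gtr0_norm ?weight_prod_gt0.
rewrite ler_wpM2l ?mulr_ge0 ?real_abs_ge0 ?(ltW (weight_prod_gt0 _ La)) //.
apply: (NP t (fun q => k + (pos q - m))%N) => [| q qt | q]; last exact: c01.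
- rewrite map_inj_in_uniq // => q q' qt q't /addnI eq_pos; apply: pos_inj.
  by rewrite -(subnK (m_le q qt)) eq_pos subnK ?m_le.
- by apply: leq_trans (leq_addl _ _); rewrite leq_subRL ?m_le ?post.
Qed.

(** Each coefficient is [alpha k] times a product of ratios [w_j(l) / w_j(mu)] in (0, 1], and the
    distance of such a product from 1 is at most the sum of the distances of its factors, each at
    most [L j * (mu - l)]. *)
Lemma iter_B_copy_close (L : nat -> R) n l mu m eta : Lambda l -> Lambda mu ->
  l <= mu ->
  (forall i, (1 <= i)%N -> 0 <= L i) ->
  (forall i, (1 <= i)%N -> `|ln (w i l) - ln (w i mu)| <= L i * `|l - mu|) ->
  (\sum_(1 <= i < (d + m).+1) L i) * (mu - l) <= eta ->
  P n (iter m (B l) (shifted_copy mu m) - \sum_(k < d) alpha k *: e k) <=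
    eta * \sum_(k < d) real_abs (alpha k) * P n (e k).
Proof.
move=> Ll Lmu lmu L0 wL etaP.
have W0 x i : Lambda x -> 0 < W x i by exact: weight_prod_gt0.
pose rho k i := W mu k / W mu (k + i) * (W l (k + i) / W l k).
have rhoP k i : 0 <= 1 - rho k i <=
    (\sum_(k.+1 <= j < (k + i).+1) L j) * (mu - l).
  elim: i => [|i /andP[IH0 IH1]].
    by rewrite /rho addn0 !divff ?gt_eqF ?W0 // mulr1 subrr big_geq ?mul0r ?lexx.
  pose r := w (k + i).+1 l / w (k + i).+1 mu.
  have wl : 0 < w (k + i).+1 l by rewrite w_gt0.
  have wmu : 0 < w (k + i).+1 mu by rewrite w_gt0.
  have rhoS : rho k i.+1 = rho k i * r.
    rewrite /rho /r addnS !weight_prodS; field.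
    by rewrite !gt_eqF ?W0.
  have r1 : r <= 1 by rewrite ler_pdivrMr // mul1r w_increasing.
  have r0 : 0 < r by rewrite divr_gt0.
  have rL : 1 - r <= L (k + i).+1 * (mu - l).
    have := wL (k + i).+1 isT; rewrite distrC (distrC l) !ger0_norm ?subr_ge0 //.
      (* From 1 + x <= exp x at x = ln r one gets 1 - r <= - ln r. *)
      move=> h; have := expR_ge1Dx (ln r); rewrite lnK ?posrE // ln_div ?posrE //.
      lra.
    by rewrite ler_ln ?posrE // w_increasing.
  have rho0 : 0 <= rho k i.
    by rewrite mulr_ge0 // divr_ge0 // ltW // W0.
  rewrite rhoS addnS big_nat_recr /=; last by rewrite ltnS leq_addr.
  rewrite mulrDl; set S := (\sum_(_ <= _ < _) _) * _ in IH1 *.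
  (* This product gives the upper bound on 1 - rho r, the next one its nonnegativity. *)
  have : 0 <= (1 - rho k i) * (1 - r) by rewrite mulr_ge0 // subr_ge0.
  have : 0 <= rho k i * (1 - r) by rewrite mulr_ge0 // subr_ge0.
  by rewrite !mulrBr !mulrBl; lra.
have := iter_B_copy mu m 0 Ll; rewrite addn0 => ->.
rewrite -sumrB mulr_sumr.
apply: le_trans (graded_sum gP _ _ _) _; apply: ler_sum => k _.
rewrite !addn0 -/(rho k m) -scalerBl (gradedZ gP) mulrA.
apply: ler_wpM2r; first exact: graded_ge0.
rewrite -[X in _ - X]mulr1 -(of_real1 R cplx) -mulrBr -of_realN -of_realD.
rewrite real_absM real_abs_of_real mulrC ler_wpM2r ?real_abs_ge0 //.
have /andP[h0 h1] := rhoP k m; rewrite distrC ger0_norm //.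
apply: le_trans h1 (le_trans _ etaP); rewrite ler_wpM2r ?subr_ge0 //.
have kd : (k.+1 <= (k + m).+1 <= (d + m).+1)%N.
  by rewrite !ltnS leq_addr leq_add2r ltnW.
rewrite [leRHS](@big_cat_nat _ _ _ k.+1) //=; last first.
  by rewrite ltnS (leq_trans (ltnW (ltn_ord k))) ?leq_addr.
rewrite [X in _ <= _ + X](@big_cat_nat _ _ _ (k + m).+1) //=; last first.
- by case/andP: kd.
- by case/andP: kd.
rewrite addrCA lerDl addr_ge0 // big_nat sumr_ge0 // => i /andP[i1 _]; apply: L0 => //.
exact: leq_trans i1.
Qed.

End Copies.

End WeightedShiftFamily.

(** * Vectors visiting a given ball for all parameters *)

(** Partial sums that stay below C would be bounded and, from k on, nondecreasing, hence
    convergent. *)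
Lemma divergent_sum_ge (R : realType) (x : nat -> R) (k N : nat) (C : R) :
  (forall i, (k <= i)%N -> 0 <= x i) ->
  ~ cvgn (fun M : nat => \sum_(k <= i < M) x i) ->
  exists M : nat, C <= \sum_(N <= i < M) x i.
Proof.
move=> x0 x_div; apply: contrapT => /forallNP x_bnd; apply: x_div.
have mono M M' : (M <= M')%N -> \sum_(k <= i < M) x i <= \sum_(k <= i < M') x i.
  have [kM MM'|Mk _] := leqP k M; last first.
    rewrite [leLHS]big_geq ?(ltnW Mk) // big_nat sumr_ge0 // => i /andP[ki _].
    exact: x0.
  rewrite [leRHS](@big_cat_nat _ _ _ M) //= lerDl big_nat sumr_ge0 // => i /andP[Mi _].
  by rewrite x0 // (leq_trans kM).
apply: nondecreasing_is_cvgn; first exact: mono.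
(* If N < k, the terms between N and k may have any sign, hence the absolute values. *)
exists (\sum_(k <= i < maxn k N) x i + `|C| +
  \sum_(N <= i < maxn k N) `|x i|) => _ [M _ <-].
pose M' := maxn (maxn k N) M.
apply: (le_trans (mono _ _ (leq_maxr (maxn k N) M))); rewrite -/M'.
have kM : (maxn k N <= M')%N by exact: leq_maxl.
rewrite (@big_cat_nat _ _ _ (maxn k N)) ?leq_maxl //= -addrA lerD2l.
have /negP := x_bnd M'; rewrite -ltNge.
rewrite (@big_cat_nat _ _ _ (maxn k N)) ?leq_maxr //=.
have : - \sum_(N <= i < maxn k N) x i <= \sum_(N <= i < maxn k N) `|x i|.
  by rewrite -sumrN ler_sum // => i _; rewrite -normrN ler_norm.
have := ler_norm C; lra.
Qed.

(** The points are partial sums of the steps, started at a and capped at b; j is the first index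
    whose point reaches l. The bound [maxn j0.+1 j1] leaves room for one index even if
    [j1 <= j0]. *)
Lemma interval_steps (R : realType) (x : nat -> R) (a b : R) (j0 j1 : nat) :
  a <= b -> (forall i, 0 <= x i) -> b - a <= \sum_(j0 <= i < j1) x i ->
  exists mu : nat -> R,
    [/\ {homo mu : i j / (i <= j)%N >-> i <= j}, forall j, a <= mu j <= b &
      forall l, a <= l <= b -> exists j,
        [/\ (j0 <= j)%N, (j < maxn j0.+1 j1)%N & l <= mu j <= l + x j]].
Proof.
move=> ab x0 x_cover; pose S j := \sum_(j0 <= i < j) x i.
have S_mono i j : (i <= j)%N -> S i <= S j.
  rewrite /S => ij; have [ji|ji] := leqP j0 i.
    by rewrite [leRHS](@big_cat_nat _ _ _ i) //= lerDl sumr_ge0.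
  by rewrite big_geq ?sumr_ge0 // ltnW.
exists (fun j => Num.min b (a + S j.+1)); split.
- by move=> i j ij; rewrite le_min !ge_min lexx /= lerD2l S_mono ?orbT.
- by move=> j; rewrite le_min ge_min ab lexx lerDl sumr_ge0.
move=> l /andP[al lb].
have exj : exists j, (j0 <= j)%N && (l <= a + S j.+1).
  exists (maxn j0.+1 j1).-1; apply/andP; split.
    by rewrite -ltnS prednK ?leq_maxl // leq_max.
  rewrite prednK ?leq_max //; have := S_mono _ _ (leq_maxr j0.+1 j1).
  by rewrite -/(S j1) in x_cover; lra.
case: (ex_minnP exj) => j /andP[j0j lj] j_min; exists j; split => //.
  rewrite -[X in (_ < X)%N]prednK ?leq_max // ltnS j_min //; apply/andP; split.
    by rewrite -ltnS prednK ?leq_maxl // leq_max.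
  rewrite prednK ?leq_max //; have := S_mono _ _ (leq_maxr j0.+1 j1).
  by rewrite -/(S j1) in x_cover; lra.
rewrite le_min lb lj /= ge_min; apply/orP; right.
have -> : S j.+1 = S j + x j by rewrite /S big_nat_recr.
rewrite addrA lerD2r; move: j0j; rewrite leq_eqVlt => /orP[/eqP <-|j0j].
  by rewrite /S big_geq ?addr0.
case: j j0j lj j_min => [//|j] j0j _ j_min; rewrite leNgt; apply/negP => /ltW lj.
by have := j_min j; rewrite lj -ltnS j0j ltnn => /(_ isT).
Qed.

Section CommonConstruction.
Variables (R : realType) (cplx : bool) (Lambda : set R).
Variables (X : topologicalLmodType (scalar_field R cplx)) (P : nat -> X -> R).
Hypothesis gP : graded_seminorms P.
Variable e : nat -> X.
Hypothesis e_basis : unconditional_basis e.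
Variable w : nat -> R -> R.
Hypothesis w_gt0 : forall n l, (1 <= n)%N -> Lambda l -> 0 < w n l.
Hypothesis B_operator : forall l, Lambda l ->
  weighted_shift_is_operator e (fun n => of_real cplx (w n l)).
Hypothesis w_increasing : forall n, (1 <= n)%N ->
  forall l m, Lambda l -> Lambda m -> l <= m -> w n l <= w n m.
Variables (a b : R) (L : nat -> R).
Hypothesis ab : a <= b.
Hypothesis ab_Lambda : forall l, a <= l <= b -> Lambda l.
Hypothesis w_series : exists y : X,
  (\sum_(1 <= v < N) of_real cplx (weight_prod w a v)^-1 *: e v)
    @[N --> \oo] --> y.
Hypothesis L_gt0 : forall i, (1 <= i)%N -> 0 < L i.
Hypothesis w_lipschitz : forall i l m, (1 <= i)%N -> a <= l <= b ->
  a <= m <= b -> `|ln (w i l) - ln (w i m)| <= L i * `|l - m|.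
Hypothesis L_divergent :
  ~ cvgn (fun N : nat => \sum_(1 <= t < N) (\sum_(1 <= i < (2 ^ t).+1) L i)^-1).

Local Notation B := (shift_at e w).

Lemma finite_approximation x n eps : 0 < eps ->
  exists (c : nat -> scalar_field R cplx) d,
    P n (\sum_(k < d) c k *: e k - x) < eps.
Proof.
move=> eps0; have [c [/(graded_cvgP gP) cx _]] := e_basis.1 x.
have [N NP] := cx n eps eps0; exists c, N.
by rewrite -(big_mkord xpredT (fun k => c k *: e k)); apply: NP.
Qed.

(** The spacing p is chosen before [x0], [eps'] and [M]; this keeps the density of the visits
    bounded below along all windows. *)
Lemma common_visits (alpha : nat -> scalar_field R cplx) d n eps : 0 < eps ->
  exists2 p, (0 < p)%N & forall x0 n' eps' M, 0 < eps' -> exists x j1,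
    P n' (x - x0) < eps' /\ forall l, a <= l <= b -> exists j,
      [/\ (M <= j)%N, (j < j1)%N & forall q, (2 ^ j <= q < 2 ^ j.+1)%N ->
        P n (iter (p * q) (B l) x - \sum_(k < d) alpha k *: e k) < eps].
Proof.
move=> eps0.
have aab : a <= a <= b by rewrite lexx.
have La := ab_Lambda aab.
pose C := \sum_(k < d) real_abs (alpha k) * P n (e k).
have C0 : 0 <= C.
  by apply: sumr_ge0 => k _; rewrite mulr_ge0 ?real_abs_ge0 ?(graded_ge0 gP).
pose eta := eps / 3 / (1 + C).
have eta0 : 0 < eta by rewrite !divr_gt0 //; lra.
have etaC : eta * C <= eps / 3.
  have : eta * (1 + C) = eps / 3 by rewrite /eta divfK // gt_eqF //; lra.
  by rewrite mulrDr; lra.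
have eps30 : 0 < eps / 3 by lra.
have [N NP] := iter_B_copies_small gP e_basis w_gt0 B_operator w_increasing
  alpha d n La eps30 w_series.
(* As p exceeds d and N, at time pq the earlier copies have vanished and the later ones are in the
   small tail. A power of 2 makes p 2^(j+1) an index occurring in (iv) with s = 2. *)
pose r := (N + d)%N; pose p := (2 ^ r)%N.
have p_gt : (N + d < p)%N by exact: ltn_expl.
have p_gt0 : (0 < p)%N by exact: leq_ltn_trans p_gt.
have pN : (N <= p)%N by rewrite (leq_trans (leq_addr d N)) // ltnW.
have pd : (d <= p)%N by rewrite (leq_trans (leq_addl N d)) // ltnW.
exists p => // x0 n' eps' M eps'0.
have eps'20 : 0 < eps' / 2 by lra.
have [c [D x0'P]] := finite_approximation x0 n' eps'20.
set x0' := \sum_(k < D) _ in x0'P.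
have [N' N'P] := iter_B_copies_small gP e_basis w_gt0 B_operator w_increasing
  alpha d n' La eps'20 w_series.
pose A t := \sum_(1 <= i < (2 ^ t).+1) L i.
have A0 t : 0 < A t.
  rewrite /A big_ltn ?ltnS ?expn_gt0 // ltr_wpDr ?L_gt0 // big_nat.
  by apply: sumr_ge0 => i /andP[/ltnW i1 _]; rewrite ltW ?L_gt0.
(* The indices of L relevant in window i are at most p 2^(i+1) = 2^(i+r+1), so a parameter gap of
   [x i] costs at most eta. *)
pose j0 := (N' + D + M)%N; pose x i := eta / A (i + r.+1)%N.
have x_ge0 i : 0 <= x i by rewrite divr_ge0 ?ltW.
have [j1 j1P] : exists j1, b - a <= \sum_(j0 <= i < j1) x i.
  have Ainv0 i : (1 <= i)%N -> 0 <= (A i)^-1 by rewrite invr_ge0 ltW.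
  (* Sums starting at any index diverge, so the shift by [r.+1] is harmless. *)
  have [M' M'P] := divergent_sum_ge (j0 + r.+1) ((b - a) / eta) Ainv0 L_divergent.
  exists (M' - r.+1)%N; rewrite -mulr_sumr -(big_addn _ _ _ xpredT (fun i => (A i)^-1)).
  by rewrite mulrC -ler_pdivrMr.
have [mu [mu_mono mu_ab mu_cover]] := interval_steps ab x_ge0 j1P.
pose j2 := maxn j0.+1 j1.
(* [trunc_log 2 q] is the number of the window containing q. *)
pose mu' q := mu (trunc_log 2 q); pose pos q := (p * q)%N.
have mu'_mono q q' : (q <= q')%N -> mu' q <= mu' q'.
  by move=> /(leq_trunc_log 2)/mu_mono.
have pos_inj : injective pos.
  by move=> q q' /eqP; rewrite eqn_pmul2l // => /eqP.
pose copy q := shifted_copy e w alpha d (mu' q) (pos q).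
exists (x0' + \sum_(2 ^ j0 <= q < 2 ^ j2) copy q), j2; split.
  have := gradedD gP n' (x0' - x0) (\sum_(2 ^ j0 <= q < 2 ^ j2) copy q).
  rewrite addrAC; have := N'P (index_iota (2 ^ j0) (2 ^ j2)) pos mu' a 0%N La
    (lexx a) (iota_uniq _ _) pos_inj.
  suff h : {in index_iota (2 ^ j0) (2 ^ j2), forall q,
      (Lambda (mu' q) /\ a <= mu' q) /\ (0 + N' <= pos q)%N}.
    move=> /(_ (fun q qt => (h q qt).1) (fun q qt => (h q qt).2)).
    by rewrite -/copy; lra.
  move=> q; rewrite mem_index_iota => /andP[jq _]; split.
    split; first by apply: ab_Lambda; apply: mu_ab.
    by case/andP: (mu_ab (trunc_log 2 q)).
  rewrite add0n; apply: leq_trans (leq_pmull _ p_gt0); apply: leq_trans jq.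
  apply: leq_trans (ltnW (ltn_expl j0 _)) => //.
  by rewrite /j0 -addnA leq_addr.
move=> l lab; have Ll := ab_Lambda lab.
have /andP[al lb] := lab.
have [j [j0j jj2 /andP[lmu mul]]] := mu_cover l lab.
exists j; split=> //; first by apply: leq_trans j0j; apply: leq_addl.
move=> q /andP[jq qj]; have mu'q : mu' q = mu j.
  by rewrite /mu' (@trunc_log_eq _ j) // jq qj.
have j0q : (2 ^ j0 <= q)%N by apply: leq_trans jq; rewrite leq_exp2l.
have qj2 : (q < 2 ^ j2)%N by apply: leq_trans qj _; rewrite leq_exp2l.
(* Split into copies before q, the q-th copy and copies after q. *)
rewrite (@big_cat_nat _ _ _ q) ?(ltnW qj2) //= [\sum_(q <= i < _) _]big_ltn //.
rewrite !(familyD (iter_B_linear B_operator (p * q))) //.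
have -> : iter (p * q) (B l) x0' = 0.
  rewrite (family_sum (iter_B_linear B_operator (p * q))) // big1 // => k _.
  rewrite (familyZ (iter_B_linear B_operator (p * q))) //.
  rewrite (iter_B_basis0 gP e_basis w_gt0 B_operator) ?scaler0 //.
  apply: leq_trans (leq_pmull _ p_gt0); apply: leq_trans j0q.
  apply: leq_trans (ltnW (ltn_expl j0 _)) => //.
  by rewrite (leq_trans (ltn_ord k)) // /j0 addnAC leq_addl.
rewrite add0r (family_sum (iter_B_linear B_operator (p * q))) //.
rewrite [\sum_(_ <= i < q) _]big_nat big1 ?add0r; last first.
  move=> q' /andP[_ q'q]; rewrite (iter_B_copy0 gP e_basis w_gt0 B_operator) //.
  apply: leq_trans (_ : p + p * q' <= _)%N; first by rewrite leq_add2r.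
  by rewrite -mulnS leq_mul2l q'q orbT.
have close : P n (iter (p * q) (B l) (copy q) - \sum_(k < d) alpha k *: e k) <=
    eta * C.
  apply: (iter_B_copy_close gP e_basis w_gt0 B_operator w_increasing alpha
    (L := L)) => //.
  - by rewrite mu'q; apply: ab_Lambda.
  - by rewrite mu'q.
  - by move=> i i1; rewrite ltW ?L_gt0.
  - by move=> i i1; apply: w_lipschitz; rewrite ?mu'q.
  rewrite mu'q; apply: (@le_trans _ _ (A (j + r.+1)%N * x j)); last first.
    by rewrite /x mulrCA divff ?mulr1 // gt_eqF.
  apply: ler_pM; [| by rewrite subr_ge0 | | by lra].
    by rewrite big_nat sumr_ge0 // => i /andP[i1 _]; rewrite ltW ?L_gt0.
  rewrite [leRHS](@big_cat_nat _ _ _ (d + p * q).+1) //=.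
    rewrite lerDl big_nat sumr_ge0 // => i /andP[i1 _].
    by rewrite ltW ?L_gt0 // (leq_trans _ i1).
  rewrite ltnS addnS -addSn expnD [leqRHS]mulnC; apply: leq_trans (_ : p + p * q <= _)%N.
    by rewrite leq_add2r.
  by rewrite -mulnS leq_mul2l qj orbT.
have tail : P n (iter (p * q) (B l) (\sum_(q.+1 <= i < 2 ^ j2) copy i)) <= eps / 3.
  apply: NP => //; first exact: iota_uniq.
    move=> i; rewrite mem_index_iota => /andP[/ltnW qi _]; split.
      by apply: ab_Lambda; apply: mu_ab.
    by apply: (le_trans lmu); rewrite -mu'q mu'_mono.
  move=> i; rewrite mem_index_iota => /andP[qi _].
  apply: leq_trans (_ : p * q + p <= _)%N; first by rewrite leq_add2l.
  by rewrite -mulnSr leq_mul2l qi orbT.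
have := gradedD gP n (iter (p * q) (B l) (copy q) - \sum_(k < d) alpha k *: e k)
  (iter (p * q) (B l) (\sum_(q.+1 <= i < 2 ^ j2) copy i)).
rewrite addrAC; lra.
Qed.

(** The visits of one vector involve iterates of order at most p 2^j1, so equicontinuity carries
    them, uniformly in l, to a neighborhood; half of eps pays for the perturbation. *)
Lemma common_visits_residual (alpha : nat -> scalar_field R cplx) d n eps :
  0 < eps -> exists (p : nat) (G : nat -> set X),
    [/\ (0 < p)%N, forall M, open (G M) /\ dense (G M) &
      forall x l M, G M x -> a <= l <= b -> exists2 j, (M <= j)%N &
        forall q, (2 ^ j <= q < 2 ^ j.+1)%N ->
          P n (iter (p * q) (B l) x - \sum_(k < d) alpha k *: e k) < eps].
Proof.
move=> eps0; have eps20 : 0 < eps / 2 by lra.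
have [p p0 pP] := common_visits alpha d n eps20.
pose V M := [set x : X | forall l, a <= l <= b -> exists2 j, (M <= j)%N &
  forall q, (2 ^ j <= q < 2 ^ j.+1)%N ->
    P n (iter (p * q) (B l) x - \sum_(k < d) alpha k *: e k) < eps].
exists p, (fun M => interior (V M)); split=> //; last first.
  by move=> x l M /interior_subset; apply.
move=> M; split; first exact: open_interior.
apply: (dense_ball gP) => x0 n' eps' eps'0.
have [x [j1 [xx0 xP]]] := pP x0 n' eps' M eps'0.
exists x; split=> //; apply/(graded_nbhs gP).
have [||z m|k [delta delta0 kP]] := @graded_equicontinuous_iter _ _ _ _ gP R
    [set l | Lambda l /\ a <= l <= b] B _ _ _ (p * 2 ^ j1)%N n _ eps20.
- by move=> l [Ll _]; have [] := B_operator Ll.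
- by move=> l [Ll _]; have [] := B_operator Ll.
- by apply: (B_bounded gP e_basis w_gt0 B_operator w_increasing);
    apply: ab_Lambda; rewrite lexx ab.
exists k, delta => // y /= yx l lab; have Ll := ab_Lambda lab.
have [j [Mj jj1 jP]] := xP l lab; exists j => // q qj.
have := kP (y - x) l (p * q)%N yx (conj Ll lab).
rewrite leq_mul2l => /(_ _)/wrap[].
  apply/orP; right; case/andP: qj => _ /ltnW qj; apply: leq_trans qj _.
  by rewrite leq_exp2l.
have -> : iter (p * q) (B l) y =
    iter (p * q) (B l) (y - x) + iter (p * q) (B l) x.
  by rewrite -(familyD (iter_B_linear B_operator (p * q))) // subrK.
have := jP q qj.
have := gradedD gP n (iter (p * q) (B l) (y - x))
  (iter (p * q) (B l) x - \sum_(k < d) alpha k *: e k).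
by rewrite addrA; lra.
Qed.

End CommonConstruction.

(** * Density and countability *)

(** A window of 2^j values q gives 2^j elements of A up to N = p 2^(j+1), and N + 1 <= 3p 2^j. *)
Lemma upper_density_gt0 (R : realType) (A : set nat) (p : nat) : (0 < p)%N ->
  (forall M, exists2 j, (M <= j)%N &
     forall q, (2 ^ j <= q < 2 ^ j.+1)%N -> A (p * q)%N) ->
  (0 < upper_density R A)%E.
Proof.
move=> p0 Ap; have delta0 : (0 < (3 * p)%:R^-1 :> R).
  by rewrite invr_gt0 ltr0n muln_gt0.
apply: (@lt_le_trans _ _ ((3 * p)%:R^-1 : R)%:E); first by rewrite lte_fin.
apply: le_ereal_inf_tmp => _ [V [M _ MV] <-].
have [j Mj Aj] := Ap M; pose N := (p * 2 ^ j.+1)%N.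
have jN : (j <= N)%N.
  by apply: leq_trans (leq_pmull _ p0); apply/ltnW/ltnW/ltn_expl.
apply: le_trans (ereal_sup_ubound (x := _) _); last first.
  by exists N; [apply: MV; exact: leq_trans jN|].
rewrite lee_fin ler_pdivlMr ?ltr0n // mulrC ler_pdivrMr ?ltr0n ?muln_gt0 //.
rewrite -natrM ler_nat.
pose f (i : 'I_(2 ^ j)) : 'I_N.+1 := inord (p * (2 ^ j + i)).
have fE i : f i = (p * (2 ^ j + i))%N :> nat.
  by rewrite inordK // ltnS leq_mul2l expnS mul2n -addnn leq_add2l ltnW ?orbT.
have f_inj : injective f.
  move=> i i' /(congr1 (@nat_of_ord _)); rewrite !fE => /eqP.
  by rewrite eqn_pmul2l // eqn_add2l => /eqP/val_inj.
have : (2 ^ j <= #|[pred k : 'I_N.+1 | (k : nat) \in A]|)%N.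
  rewrite -[X in (X <= _)%N]card_ord -(card_codom f_inj).
  apply/subset_leq_card/fintype.subsetP => _ /codomP[i ->].
  rewrite inE fE; apply: Aj.
  by rewrite leq_addr expnS mul2n -addnn ltn_add2l /=.
have : (0 < 2 ^ j)%N by rewrite expn_gt0.
rewrite /N expnS; set c := #|_|; move: (2 ^ j)%N => t t0 tc.
apply: leq_trans (_ : t * (3 * p) <= _)%N; last by rewrite leq_mul2r tc orbT.
have : (0 < p * t)%N by rewrite muln_gt0 p0.
by rewrite mulnCA [(t * _)%N]mulnC -mulnA; lia.
Qed.

(** Without a minimum, choose for each rational having an element of A below it one such element;
    between x and a smaller element of A there is a rational. *)
Lemma countable_coinitial (R : realType) (A : set R) : A !=set0 ->
  exists2 f : nat -> R, forall n, A (f n) &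
    forall x, A x -> exists n, f n <= x.
Proof.
move=> [x0 Ax0].
have [[m Am mA]|no_min] := pselect (exists2 m, A m & forall x, A x -> m <= x).
  by exists (fun=> m) => // x Ax; exists 0%N; apply: mA.
have /choice[f fP] : forall n : nat, exists y, A y /\
    forall q : rat, unpickle n = Some q -> (exists2 z, A z & z <= ratr q) ->
      y <= ratr q.
  move=> n; case: (unpickle n) => [q|]; last by exists x0.
  have [[z Az zq]|nz] := pselect (exists2 z, A z & z <= ratr q).
    by exists z; split=> // _ [<-].
  by exists x0; split=> // _ [<-].
exists f => [n|x Ax]; first by have [] := fP n.
have [x' Ax' x'x] : exists2 x', A x' & x' < x.
  apply: contrapT => nx; apply: no_min; exists x => // y Ay.
  by rewrite leNgt; apply/negP => yx; apply: nx; exists y.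
have [q] := rat_in_itvoo x'x; rewrite in_itv /= => /andP[q1 q2].
exists (pickle q); have [_ /(_ q (pickleK q))] := fP (pickle q).
move=> h; apply: le_trans (ltW q2); apply: h; exists x' => //; exact: ltW.
Qed.

Lemma interval_countable_cover (R : realType) (A : set R) : A !=set0 ->
  exists2 f : nat * nat -> R * R,
    forall i, [/\ A (f i).1, A (f i).2 & (f i).1 <= (f i).2] &
    forall x, A x -> exists i, (f i).1 <= x <= (f i).2.
Proof.
move=> A0; have [f fA fP] := countable_coinitial A0.
have [|g gA gP] := @countable_coinitial R [set x | A (- x)].
  by case: A0 => x Ax; exists (- x) => /=; rewrite opprK.
(* The maximum keeps the endpoints in order. *)
exists (fun i => (f i.1, Num.max (f i.1) (- g i.2))) => [i|x Ax] /=.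
  split; [exact: fA | | by rewrite le_max lexx].
  by rewrite maxEle; case: ifP => _; [exact: gA | exact: fA].
have [i fi] := fP x Ax; have [|j gj] := gP (- x); first by rewrite /= opprK.
by exists (i, j); rewrite fi le_max /=; apply/orP; right; rewrite lerNr.
Qed.

Lemma residual_countable (X : topologicalType) (I : countType) (A : set X)
    (G : I -> set X) :
  (forall i, open (G i) /\ dense (G i)) -> \bigcap_i G i `<=` A -> residual A.
Proof.
move=> Gd GA; exists (fun k => if unpickle k is Some i then G i else setT).
  move=> k; case: (unpickle k) => [i|]; first exact: Gd.
  by split; [exact: openT | move=> O O0 _; rewrite setIT].
move=> x Gx; apply: GA => i _; have := Gx (pickle i) Logic.I.
by rewrite pickleK.
Qed.

(** * Intersection over countably many intervals, targets and tolerances *)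

Theorem theorem10 (R : realType) (cplx : bool)
  (Lambda : set R)
  (X : topologicalLmodType (scalar_field R cplx))
  (e : nat -> X)
  (w : nat -> R -> R)
  (L : set R -> nat -> R)
  (Lambda_interval : is_interval Lambda)
  (X_frechet : is_frechet X)
  (e_basis : unconditional_basis e)
  (w_gt0 : forall n l, (1 <= n)%N -> Lambda l -> 0 < w n l)
  (B_operator : forall l, Lambda l ->
    weighted_shift_is_operator e (fun n => of_real cplx (w n l)))
  (w_increasing : forall n, (1 <= n)%N ->
    forall l m, Lambda l -> Lambda m -> l <= m -> w n l <= w n m)
  (w_series : forall l, Lambda l ->
    exists y : X,
      (\sum_(1 <= v < N)
         of_real cplx (\prod_(1 <= i < v.+1) w i l)^-1 *: e v)
        @[N --> \oo] --> y)
  (w_lipschitz : forall K, compact_subinterval Lambda K ->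
    forall n, (1 <= n)%N ->
      0 < L K n /\
      forall l m, K l -> K m ->
        `|ln (w n l) - ln (w n m)| <= L K n * `|l - m|)
  (L_divergent : forall K, compact_subinterval Lambda K ->
    forall s, (1 <= s)%N ->
      ~ cvgn (fun N : nat =>
          \sum_(1 <= t < N) (\sum_(1 <= i < (s ^ t).+1) L K i)^-1)) :
  residual (common_upper_frequently_hypercyclic R Lambda
    (fun l => weighted_shift e (fun n => of_real cplx (w n l)))) /\
  common_upper_frequently_hypercyclic R Lambda
    (fun l => weighted_shift e (fun n => of_real cplx (w n l))) !=set0.
Proof.
have [P gP] := frechet_graded_seminorms X_frechet.
set C := common_upper_frequently_hypercyclic _ _ _.
suff resC : residual C.
  split=> //; have [G Gd GC] := resC.
  have [|x [_ /GC Cx]] := graded_baire gP Gd _ openT; last by exists x.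
  by exists 0.
(* For empty [Lambda] every vector qualifies. *)
have [Lambda0|/nonemptyPn Lambda0] := pselect (Lambda !=set0); last first.
  exists (fun=> setT) => [_|x _ l]; last by rewrite Lambda0.
  by split; [exact: openT | move=> O O0 _; rewrite setIT].
have [f f_Lambda f_cover] := interval_countable_cover Lambda0.
have [D D_dense] := countable_dense_scalars R cplx.
pose target (s : seq nat) := \sum_(k < size s) D (nth 0%N s k) *: e k.
(* The index holds a compact interval, the code s of a target, and one n serving both as seminorm
   index and for the tolerance 1/(n+1). *)
have visits (i : nat * nat * (seq nat * nat)) : exists pG : nat * (nat -> set X),
    [/\ (0 < pG.1)%N, forall M, open (pG.2 M) /\ dense (pG.2 M) &
      forall x l M, pG.2 M x -> (f i.1).1 <= l <= (f i.1).2 ->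
        exists2 j, (M <= j)%N & forall q, (2 ^ j <= q < 2 ^ j.+1)%N ->
          P i.2.2 (iter (pG.1 * q) (shift_at e w l) x - target i.2.1) <
            i.2.2.+1%:R^-1].
  case: i => i [s n] /=; have [Lf1 Lf2 f12] := f_Lambda i.
  pose K := `[(f i).1, (f i).2]%classic.
  have KE l : K l = ((f i).1 <= l <= (f i).2) by rewrite /K /= in_itv.
  have K_Lambda l : (f i).1 <= l <= (f i).2 -> Lambda l by exact: Lambda_interval.
  have K_sub : compact_subinterval Lambda K.
    split; first by exists (f i).1; rewrite KE lexx.
    - exact: segment_compact.
    - exact: interval_is_interval.
    - by move=> l; rewrite KE; apply: K_Lambda.
  have n0 : 0 < n.+1%:R^-1 :> R by rewrite invr_gt0.
  have [|||p [G [p0 Gd GP]]] := common_visits_residual gP e_basis w_gt0 B_operator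
    w_increasing (L := L K) f12 K_Lambda (w_series _ Lf1) _ _ _
    (fun k => D (nth 0%N s k)) (size s) n n0.
  - by move=> k k1; have [] := w_lipschitz K K_sub k k1.
  - move=> k l m k1 lK mK; have [_] := w_lipschitz K K_sub k k1.
    by apply; rewrite KE.
  - exact: L_divergent.
  by exists (p, G).
have [pG pGP] := choice visits.
apply: (residual_countable (I := (nat * nat * (seq nat * nat) * nat)%type)
  (G := fun i => (pG i.1).2 i.2)) => [[i M]|x Gx l Ll U oU [u Uu]].
  by have [_ + _] := pGP i; apply.
have [i il] := f_cover l Ll.
have [n [eps eps0 nU]] := graded_openP gP oU Uu.
have eps30 : 0 < eps / 3 by lra.
have [c [d cd]] := finite_approximation gP e_basis u n eps30.
pose S := \sum_(k < d) P n (e k).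
have S0 : 0 <= S by apply: sumr_ge0 => k _; apply: graded_ge0.
have eta0 : 0 < eps / 3 / (1 + S) by rewrite !divr_gt0 //; lra.
have [s sP] := choice (fun k => D_dense (c k) _ eta0).
(* One third of eps each for truncating u, for replacing its coefficients by values of D, and for
   the visit; [n'] makes 1/(n'+1) < eps/3. *)
pose t := mkseq s d; pose n' := maxn n (Num.truncn (eps / 3)^-1).
have [p0 _ visit] := pGP (i, (t, n')).
apply: (@upper_density_gt0 R _ _ p0) => M.
have [j Mj jP] := visit x l M (Gx (i, (t, n'), M) Logic.I) il.
exists j => // q qj; apply: nU => /=.
set y := iter _ _ _.
have yt : P n (y - target t) < eps / 3.
  apply: le_lt_trans (graded_le gP _ (leq_maxl n _)) _.
  apply: lt_trans (jP q qj) _.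
  rewrite /= invf_plt ?posrE ?ltr0n //.
  by apply: (lt_le_trans (truncnS_gt _)); rewrite ler_nat ltnS leq_maxr.
have tc : P n (target t - \sum_(k < d) c k *: e k) <= eps / 3.
  rewrite (graded_distC gP) /target size_mkseq -sumrB.
  apply: le_trans (graded_sum gP _ _ _) _.
  apply: (@le_trans _ _ (\sum_(k < d) eps / 3 / (1 + S) * P n (e k))).
    apply: ler_sum => k _; rewrite nth_mkseq // -scalerBl (gradedZ gP).
    by rewrite ler_wpM2r ?(graded_ge0 gP) // ltW.
  rewrite -mulr_sumr -/S mulrAC ler_pdivrMr; last by lra.
  by rewrite ler_wpM2l; lra.
have := graded_distD gP n (target t) y u.
have := graded_distD gP n (\sum_(k < d) c k *: e k) (target t) u.
lra.
Qed.
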